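(* Let $r\ge 3$ and let $G$ be a finite graph with bipartite induced matching number $t$. For any family $\mathcal{G}\subseteq \mathcal{C}(G)$, if $\mathcal{G}$ has the $(r,2)$-property, then $\tau(\mathcal{G})\le C(r,t)$ for some constant $C(r,t)$ depending only on $r$ and $t$. In particular, if $G$ is $\alpha$-ultra maximal $K_r$-free for some $\alpha>0$, then $\tau(\mathcal{G})\le C'(r,\alpha)$ for some constant depending only on $r$ and $\alpha$.
   Context: Let $\mathrm{MIS}(G)$ be the set of all maximal independent sets of $G$. For $S\subseteq V(G)$ let $K_S=\{I\in \mathrm{MIS}(G): S\subseteq I\}$, and write $K_v=K_{\{v\}}$. The convexity space $\mathcal{C}(G)$ is the family $\{K_S: S\subseteq V(G)\}$ of subsets of the ground set $X=\mathrm{MIS}(G)$ (equivalently, the closure of $\{K_v: v\in V(G)\}$ under taking intersections of subfamilies). A family of sets has the $(r,2)$-property if among any $r$ of its members there are two with nonempty intersection. A transversal of $\mathcal{G}$ is a set $T\subseteq X$ meeting every member of $\mathcal{G}$; $\tau(\mathcal{G})$ is the minimum size of a transversal. A bipartite induced matching of size $t$ in $G$ is a set of $2t$ distinct vertices $u_1,\dots,u_t,v_1,\dots,v_t$ such that $u_iv_j\in E(G)$ if and only if $i=j$; the bipartite induced matching number is the largest such $t$. An $n$-vertex graph $G$ is $\alpha$-ultra maximal $K_r$-free if it is $K_r$-free and for every pair of non-adjacent vertices $u,v$, the induced subgraph $G[N(u)\cap N(v)]$ contains at least $\alpha n^{r-2}$ copies of $K_{r-2}$.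
   Formalization: All members of the family 𝒢 are required to be nonempty; otherwise 𝒢 = {∅}, with ∅ = K_S for a non-independent S, has the (r,2)-property vacuously but admits no transversal, so the bound on τ fails. *)

(* Defs.v *)
From HB Require Import structures.
From mathcomp Require Import all_boot all_order all_algebra.
From mathcomp Require Import reals.
Set Implicit Arguments. Unset Strict Implicit. Unset Printing Implicit Defensive.
Import Order.TTheory GRing.Theory Num.Theory.

Definition simple_graph (T : finType) (e : rel T) : Prop :=
  symmetric e /\ irreflexive e.

Section Graphs.
Variables (T : finType) (e : rel T).

Definition independent (I : {set T}) : bool :=
  [forall x in I, forall y in I, ~~ e x y].

Definition is_mis (I : {set T}) : bool :=
  independent I && [forall J : {set T}, (I \subset J) && independent J ==> (J == I)].

Definition MIS : {set {set T}} := [set I | is_mis I].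

Definition KS (S : {set T}) : {set {set T}} := [set I in MIS | S \subset I].

Definition convexity_space : {set {set {set T}}} := [set KS S | S : {set T}].

Definition r2_property (r : nat) (F : {set {set {set T}}}) : Prop :=
  forall H : {set {set {set T}}}, H \subset F -> #|H| = r ->
    exists A B, [/\ A \in H, B \in H, A != B & A :&: B != set0].

Definition mis_transversal (F : {set {set {set T}}}) (X : {set {set T}}) : Prop :=
  X \subset MIS /\ forall A, A \in F -> A :&: X != set0.

Definition has_bim (t : nat) : Prop :=
  exists (u v : 'I_t -> T),
    [/\ injective u, injective v, (forall i j, u i != v j) &
        (forall i j, e (u i) (v j) = (i == j))].

Definition bim_number (t : nat) : Prop :=
  has_bim t /\ forall t', has_bim t' -> t' <= t.

Definition clique (S : {set T}) : bool :=
  [forall x in S, forall y in S, (x != y) ==> e x y].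

Definition Kr_free (r : nat) : Prop :=
  forall S : {set T}, #|S| = r -> ~~ clique S.

Definition nbhd (x : T) : {set T} := [set y | e x y].

Definition common_cliques (k : nat) (u v : T) : nat :=
  #|[set S : {set T} | (S \subset nbhd u :&: nbhd v) && (#|S| == k) && clique S]|.

Definition ultra_maximal_Kr_free (R : realType) (alpha : R) (r : nat) : Prop :=
  Kr_free r /\
  forall u v : T, u != v -> ~~ e u v ->
    (alpha * (#|T|%:R) ^+ (r - 2) <= (common_cliques (r - 2) u v)%:R)%R.

End Graphs.

(* Main.v *)
(** Call two independent sets [S], [S'] conflicting when an edge joins them; a
    family of [K_S] has a common point iff the sets [S] are pairwise not in
    conflict. So one has to bound the chromatic number of the conflict graph in
    terms of its clique number (below [r]) and of [t]. Take a maximal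
    conflict-free subfamily, with union [W]: every other [S] is adjacent to a
    vertex of [W], and a minimal subset of [W] dominating all these [S] has at
    most [t] elements, because private neighbours yield a bipartite induced
    matching. The remaining sets are thus covered by at most [t]
    neighbourhoods in the conflict graph, where the clique number is smaller:
    C(r + 1) <= 1 + t C(r).

    For an ultra maximal graph with a bipartite induced matching [u_i v_i], let
    Phi(i, j) count the pairs [(z, L)] with [z] in N(u_i) and [L] an
    (r-2)-clique in the common neighbourhood of [u_j] and [z]. Then
    Phi(i, i) = 0 by K_r-freeness. For [i <> j] each (r-2)-clique in
    N(u_i) and N(v_j) contains a [z] not adjacent to [u_j], which gives linearly
    many such [z], and each has many [L]: Phi(i, j) >= (alpha^2 / 2) n^(r-1).
    Sampling shows that a bilinear form takes such values only for boundedly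
    many indices. *)
Require Import Defs.
From HB Require Import structures.
From mathcomp Require Import all_boot all_order all_algebra.
From mathcomp Require Import reals.
From mathcomp Require Import lra ring.
Import Order.TTheory GRing.Theory Num.Theory.

Set Implicit Arguments.
Unset Strict Implicit.
Unset Printing Implicit Defensive.

(** * Independent sets, domination, and covering by maximal independent sets *)

Section Independent.
Variables (T : finType) (e : rel T).
Hypothesis eS : symmetric e.

Lemma independentP (I : {set T}) :
  reflect {in I &, forall x y, ~~ e x y} (independent e I).
Proof.
apply: (iffP forall_inP) => [H x y xI yI|H x xI].
  by have /forall_inP := H x xI; apply.
by apply/forall_inP => y yI; apply: H.
Qed.

Lemma independentS (I J : {set T}) :
  I \subset J -> independent e J -> independent e I.
Proof.
move=> /subsetP IJ /independentP H; apply/independentP => x y xI yI.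
by apply: H; apply: IJ.
Qed.

Lemma independent_sub_mis (I : {set T}) :
  independent e I -> exists2 M, M \in MIS e & I \subset M.
Proof.
move=> indI; have [M /maxsetP[indM maxM] IM] := maxset_exists indI.
exists M => //; rewrite inE /is_mis indM /=.
by apply/forallP => J; apply/implyP => /andP[MJ indJ]; apply/eqP/maxM.
Qed.

Lemma independentUP (I J : {set T}) :
  independent e I -> independent e J ->
  reflect (exists x y, [/\ x \in I, y \in J & e x y]) (~~ independent e (I :|: J)).
Proof.
move=> /independentP iI /independentP iJ; apply: (iffP idP); last first.
  case=> x [y [xI yJ exy]]; apply/negP => /independentP/(_ x y).
  by rewrite exy !inE xI yJ orbT => /(_ isT isT).
case/forall_inPn => x xIJ /forall_inPn[y yIJ]; rewrite negbK => exy.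
move: xIJ yIJ; rewrite !inE => /orP[xI|xJ] /orP[yI|yJ].
- by have := iI x y xI yI; rewrite exy.
- by exists x, y.
- by exists y, x; rewrite eS.
- by have := iJ x y xJ yJ; rewrite exy.
Qed.

Lemma independent_cover (P : {set {set T}}) :
  {in P &, forall S S', independent e (S :|: S')} -> independent e (cover P).
Proof.
move=> H; apply/independentP => x y /bigcupP[S SP xS] /bigcupP[S' S'P yS'].
by have /independentP := H _ _ SP S'P; apply; rewrite inE ?xS ?yS' ?orbT.
Qed.

(* For [w] in a minimal dominating [U], the private neighbours of the elements
   of [U] form a bipartite induced matching. *)
Lemma small_dominating_set (t : nat) (W : {set T}) (F : {set {set T}}) :
  (forall t', has_bim e t' -> t' <= t) -> independent e W ->
  (forall S, S \in F -> exists w v, [/\ w \in W, v \in S & e w v]) ->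
  exists2 U : {set T}, U \subset W & #|U| <= t /\
    forall S, S \in F -> exists w v, [/\ w \in U, v \in S & e w v].
Proof.
move=> le_t /independentP indW domW.
pose dom (U : {set T}) :=
  [forall S in F, exists w in U, exists v in S, e w v].
have domP (U : {set T}) : reflect (forall S, S \in F ->
    exists w v, [/\ w \in U, v \in S & e w v]) (dom U).
  apply: (iffP forall_inP) => H S /H.
    by case/exists_inP => w wU /exists_inP[v vS ewv]; exists w, v.
  case=> w [v [wU vS ewv]]; apply/exists_inP; exists w => //.
  by apply/exists_inP; exists v.
have [U /minsetP[domU minU] UW] := minset_exists (introT (domP W) domW).
exists U => //; split; last exact/domP.
have priv w : exists v, w \in U ->
    e w v /\ forall w', w' \in U -> w' != w -> ~~ e w' v.
  have [wU|] := boolP (w \in U); last by move=> ?; exists w.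
  have: ~~ dom (U :\ w).
    apply/negP => /minU/(_ (subsetDl _ _))/setP/(_ w).
    by rewrite wU !inE eqxx.
  case/forall_inPn => S SF /exists_inPn nS.
  have [w' [v [w'U vS ewv]]] := (domP U domU) S SF.
  have nSv w'' : w'' \in U -> w'' != w -> ~~ e w'' v.
    move=> w''U ne; have := nS w''; rewrite !inE ne w''U => /(_ isT).
    by move/exists_inPn => /(_ v vS).
  exists v => _; split=> //.
  by case: (eqVneq w' w) => [<- //|/(nSv _ w'U)]; rewrite ewv.
have [f fP] := fin_all_exists priv.
apply: le_t; exists (@enum_val _ (mem U)), (fun i => f (enum_val i)).
have uE i j : e (enum_val i) (f (@enum_val _ (mem U) j)) = (i == j).
  have [e1 e2] := fP _ (enum_valP j).
  have [->|ne] := eqVneq i j; first exact: e1.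
  by apply/negbTE/e2; [exact: enum_valP|rewrite (inj_eq enum_val_inj)].
split=> //.
- exact: enum_val_inj.
- by move=> i j fij; apply/eqP; rewrite -uE -fij uE.
(* If [u_i = v_j], the edge [u_j v_j] would join two vertices of [U], inside the independent set
   [W]. *)
- move=> i j; apply/eqP => Eij; have := uE j j; rewrite -Eij eqxx.
  by apply/negP/indW; apply: (subsetP UW); exact: enum_valP.
Qed.

(** The value at [r = 0] is vacuous: the empty subfamily contains no pair, so no family has the
    property. *)
Fixpoint transversal_bound (r t : nat) : nat :=
  if r is r'.+1 then (t * transversal_bound r' t).+1 else 0.

(** Works with the sets [S] in place of [K_S]: nonemptiness becomes independence of [S],
    intersection becomes independence of a union. Induction on [r]. *)
Lemma mis_cover (r t : nat) (F : {set {set T}}) :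
  (forall t', has_bim e t' -> t' <= t) ->
  (forall S, S \in F -> independent e S) ->
  (forall H : {set {set T}}, H \subset F -> #|H| = r ->
     exists S S', [/\ S \in H, S' \in H, S != S' & independent e (S :|: S')]) ->
  exists X : {set {set T}}, [/\ X \subset MIS e,
    (forall S, S \in F -> exists2 M, M \in X & S \subset M) &
    #|X| <= transversal_bound r t].
Proof.
move=> le_t; elim: r F => [|r IHr] F indF propF.
  by have [S [S' []]] := propF set0 (sub0set _) (cards0 _); rewrite inE.
pose compat (P : {set {set T}}) := (P \subset F) &&
  [forall S in P, forall S' in P, independent e (S :|: S')].
have compat0 : compat set0.
  by rewrite /compat sub0set; apply/forall_inP => S; rewrite inE.
have [P /maxsetP[/andP[PF /forall_inP cP] maxP] _] := maxset_exists compat0.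
have {}cP : {in P &, forall S S', independent e (S :|: S')}.
  by move=> S S' /cP/forall_inP; apply.
have indW := independent_cover cP.
have domW S : S \in F :\: P ->
    exists w v, [/\ w \in cover P, v \in S & e w v].
  rewrite inE => /andP[SP SF].
  have: ~~ compat (S |: P).
    apply: contra SP => cSP.
    by rewrite -(maxP _ cSP (subsetUr _ _)) setU11.
  rewrite /compat subUset sub1set SF PF /=.
  have conf S' : S' \in P -> ~~ independent e (S' :|: S) ->
      exists w v, [/\ w \in cover P, v \in S & e w v].
    move=> S'P /independentUP-/(_ (indF _ (subsetP PF _ S'P)) (indF _ SF)).
    case=> w [v [wS' vS ewv]]; exists w, v; split=> //.
    by apply/bigcupP; exists S'.
  case/forall_inPn => S1 S1P /forall_inPn[S2 S2P].
  move: S1P S2P; rewrite !inE => /predU1P[->|S1P] /predU1P[->|S2P].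
  - by rewrite setUid indF.
  - by rewrite setUC; apply: conf.
  - exact: conf.
  - by rewrite cP.
have [U UW [Ut domU]] := small_dominating_set le_t indW domW.
have [M0 M0mis WM0] := independent_sub_mis indW.
have nbX w : exists X : {set {set T}}, w \in U -> [/\ X \subset MIS e,
    (forall S v, S \in F -> v \in S -> e w v -> exists2 M, M \in X & S \subset M) &
    #|X| <= transversal_bound r t].
  have [wU|] := boolP (w \in U); last by exists set0.
  have /bigcupP[Sw SwP wSw] := subsetP UW _ wU.
  have SwF := subsetP PF _ SwP.
  pose Fw := [set S in F | [exists v in S, e w v]].
  have FwF : Fw \subset F by apply/subsetP => S; rewrite inE => /andP[].
  have confw S : S \in Fw -> ~~ independent e (Sw :|: S).
    rewrite inE => /andP[SF /exists_inP[v vS ewv]].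
    by apply/independentUP; [exact: indF|exact: indF|exists w, v].
  have [||X [X1 X2 X3]] := IHr Fw.
  - by move=> S /(subsetP FwF); apply: indF.
  (* [Sw] conflicts with all of [Fw]. Adding it to [r] members gives [r + 1] sets, whose compatible
     pair must avoid [Sw]. *)
  - move=> H HFw cH.
    have SwH : Sw \notin H.
      apply/negP => /(subsetP HFw)/confw; rewrite setUid.
      by rewrite indF.
    have [||S [S' [SH S'H nS iS]]] := propF (Sw |: H).
    + by rewrite subUset sub1set SwF (subset_trans HFw).
    + by rewrite cardsU1 SwH cH.
    move: SH S'H nS iS; rewrite !inE => /predU1P[->|SH] /predU1P[->|S'H].
    + by rewrite eqxx.
    + by move=> _; rewrite (negbTE (confw _ (subsetP HFw _ S'H))).
    + by move=> _; rewrite setUC (negbTE (confw _ (subsetP HFw _ SH))).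
    + by move=> nS iS; exists S, S'.
  exists X => _; split=> // S v SF vS ewv; apply: X2; rewrite inE SF /=.
  by apply/exists_inP; exists v.
have [X XP] := fin_all_exists nbX.
exists (M0 |: \bigcup_(w in U) X w); split.
- rewrite subUset sub1set M0mis /=; apply/bigcupsP => w wU.
  by have [] := XP w wU.
- move=> S SF; have [SP|SP] := boolP (S \in P).
    exists M0; first exact: setU11.
    by apply: subset_trans WM0; apply: (bigcup_max S).
  have [|w [v [wU vS ewv]]] := domU S; first by rewrite inE SP.
  have [_ Xc _] := XP w wU; have [M MX SM] := Xc S v SF vS ewv.
  by exists M => //; apply/setU1P; right; apply/bigcupP; exists w.
- rewrite (leq_trans (leq_card_setU _ _)) // cards1 add1n ltnS.
  have cU : #|\bigcup_(w in U) X w| <= \sum_(w in U) #|X w|.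
    elim/big_rec2: _ => [|w n A wU le_n]; first by rewrite cards0.
    by rewrite (leq_trans (leq_card_setU _ _)) // leq_add2l.
  apply: (leq_trans cU).
  apply: (@leq_trans (\sum_(w in U) transversal_bound r t)).
    by apply: leq_sum => w /XP[].
  by rewrite sum_nat_const leq_mul2r Ut orbT.
Qed.

(** A maximal independent set lies in [K_S] exactly when it contains [S], so a cover of chosen
    representatives [S] is a transversal. *)
Lemma convexity_transversal (r t : nat) (F : {set {set {set T}}}) :
  (forall t', has_bim e t' -> t' <= t) ->
  F \subset convexity_space e ->
  (forall A, A \in F -> A != set0) ->
  r2_property r F ->
  exists X : {set {set T}},
    mis_transversal e F X /\ #|X| <= transversal_bound r t.
Proof.
move=> le_t Fconv Fn0 Fr2.
have rep A : exists S, A \in F -> A = KS e S.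
  have [/(subsetP Fconv)/imsetP[S _ AS]|_] := boolP (A \in F).
    by exists S.
  by exists set0.
have [f fP] := fin_all_exists rep.
have indf A : A \in F -> independent e (f A).
  move=> AF; have /set0Pn[M MA] := Fn0 A AF.
  have : M \in KS e (f A) by rewrite -fP.
  rewrite inE.
  case/andP; rewrite inE => /andP[iM _] fAM.
  exact: independentS fAM iM.
have [||X [Xmis Xc cX]] := @mis_cover r t (f @: F) le_t.
- by move=> S /imsetP[A AF ->]; apply: indf.
- move=> H HF cH.
  (* On chosen representatives [KS] is inverse to [f], hence injective: [r] sets in [H] give [r]
     distinct members of [F]. *)
  have kerf S : S \in H -> KS e S \in F /\ f (KS e S) = S.
    by move=> /(subsetP HF)/imsetP[A AF ->]; rewrite -(fP A AF).
  have [||A [B [AH BH nAB]]] := Fr2 (KS e @: H).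
  - by apply/subsetP => A /imsetP[S /kerf[SF _] ->].
  - rewrite card_in_imset // => S S' /kerf[_ fS] /kerf[_ fS'] SS'.
    by rewrite -fS -fS' SS'.
  move: AH BH nAB => /imsetP[S SH ->] /imsetP[S' S'H ->] nAB /set0Pn[M].
  rewrite !inE => /andP[/andP[/andP[iM _] SM] /andP[_ S'M]].
  exists S, S'; split=> //; first by apply: contraNneq nAB => ->.
  by apply: independentS iM; rewrite subUset SM.
exists X; split=> //; split=> // A AF.
have [M MX SM] := Xc (f A) (imset_f f AF).
apply/set0Pn; exists M; rewrite inE MX andbT (fP A AF) inE SM andbT.
exact: (subsetP Xmis).
Qed.

End Independent.

(** * Sampling and bilinear forms vanishing on the diagonal *)

Local Open Scope ring_scope.

(* Greedy form of the second moment method: the next sample point is chosen so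
   that the total squared deviation grows by at most its average increment. *)
Lemma small_deviation_sample (R : realFieldType) (V W I : finType)
    (D : {set W}) (h : I -> W -> V -> R) (b : R) (m : nat) :
  (0 < #|V|)%N ->
  (forall i L, \sum_z h i L z = 0) -> (forall i L z, h i L z ^+ 2 <= b) ->
  exists s : m.-tuple V,
    \sum_i \sum_(L in D) (\sum_(z <- s) h i L z) ^+ 2
      <= m%:R * (#|I|%:R * (#|D|%:R * b)).
Proof.
move=> V_gt0 h0 hb; elim: m => [|m [s IHs]].
  exists [tuple]; rewrite mul0r big1 // => i _; rewrite big1 // => L _.
  by rewrite big_nil expr0n.
set E := _ * (_ * b) in IHs *.
pose S i L := \sum_(z <- s) h i L z.
pose P z := \sum_i \sum_(L in D) (h i L z + S i L) ^+ 2.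
suff /existsP[z Pz] : [exists z, P z <= m.+1%:R * E].
  exists [tuple of z :: s]; apply: le_trans Pz.
  by apply: ler_sum => i _; apply: ler_sum => L _; rewrite big_cons.
apply/existsP; apply/existsP; apply: contraT; rewrite negb_exists => /forallP nP.
(* Summed over [z], the cross terms vanish because [h i L] has sum zero, so the mean of [P] exceeds
   the old deviation by at most [E]. *)
have sumP : \sum_z P z <= #|V|%:R * (m.+1%:R * E).
  rewrite /P exchange_big /=.
  apply: (@le_trans _ _ (\sum_i \sum_(L in D) (#|V|%:R * b + #|V|%:R * S i L ^+ 2))).
    apply: ler_sum => i _; rewrite exchange_big /=; apply: ler_sum => L _.
    under eq_bigr do rewrite sqrrD -mulrnAr.
    rewrite !big_split /= -mulr_suml h0 mul0r addr0 sumr_const.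
    rewrite -[X in _ + X]mulr_natl lerD2r.
    rewrite mulr_natl -sumr_const; exact: ler_sum.
  under eq_bigr do rewrite big_split /= sumr_const -mulr_sumr.
  rewrite big_split /= sumr_const -mulr_sumr -[m.+1%:R]natr1 mulrDl mul1r.
  rewrite mulrDr addrC lerD ?ler_wpM2l //.
  rewrite -[leLHS]mulr_natl -[X in _ * X]mulr_natl /E.
  by rewrite [leRHS]mulrCA [X in _ <= _ * X]mulrCA.
have : \sum_(z : V) (m.+1%:R * E) < \sum_z P z.
  case/card_gt0P: V_gt0 => z0 _.
  apply: ltr_sum => [|z _]; last by rewrite ltNge nP.
  by apply/hasP; exists z0; rewrite ?mem_index_enum.
by rewrite sumr_const -[ltLHS]mulr_natl ltNge sumP.
Qed.

(* Maurey's empirical method: a sample of [m] points of [V] determines, up to a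
   small error in l^2 and through the trace of [A i] on it alone, the degrees
   of the [L] into [A i]; so if there were too many indices, two of them could
   not be told apart by the bilinear form counting pairs. *)
Lemma diagonal_free_bound (R : realFieldType) (V W I : finType)
    (D : {set W}) (A : I -> {set V}) (B : I -> {set W}) (M : V -> W -> bool)
    (N m : nat) (b : R) :
  (0 < #|V|)%N -> (0 < N)%N -> (#|D| <= N)%N -> 0 < b -> 8 < m%:R * b ^+ 2 ->
  (forall i, B i \subset D) ->
  (forall i z L, z \in A i -> L \in B i -> ~~ M z L) ->
  (forall i j, i != j ->
     b * #|V|%:R * N%:R <= \sum_(L in B j) #|[set z in A i | M z L]|%:R) ->
  (#|I| <= 2 * 2 ^ m)%N.
Proof.
move=> V_gt0 N_gt0 DN b0 bm BD diag off.
set n := #|V| in V_gt0 off *.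
pose c i L : R := #|[set z in A i | M z L]|%:R.
pose a i L z : R := ((z \in A i) && M z L)%:R.
pose h i L z := n%:R * a i L z - c i L.
have ca i L : c i L = \sum_z a i L z.
  rewrite /c -sum1_card natr_sum big_mkcond; apply: eq_bigr => z _.
  by rewrite inE /a; case: (_ && _).
have c0 i L : 0 <= c i L by rewrite /c.
have cn i L : c i L <= n%:R by rewrite ler_nat max_card.
have h0 i L : \sum_z h i L z = 0.
  by rewrite /h sumrB -mulr_sumr -ca sumr_const -[X in _ - X]mulr_natl subrr.
have hb i L z : h i L z ^+ 2 <= n%:R ^+ 2.
  have := c0 i L; have := cn i L; rewrite /h /a.
  by case: (_ && _) => /=; nra.
have [s Es] := small_deviation_sample D m V_gt0 h0 hb.
pose E i := \sum_(L in D) (\sum_(z <- s) h i L z) ^+ 2.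
have E0 i : 0 <= E i by apply: sumr_ge0 => L _; exact: sqr_ge0.
have m0 : 0 < m%:R :> R.
  by rewrite ltr0n; case: m bm {s Es E E0} => //; rewrite mul0r ltNge ler0n.
have n0 : 0 < n%:R :> R by rewrite ltr0n.
have N0 : 0 < N%:R :> R by rewrite ltr0n.
have DN' : #|D|%:R <= N%:R :> R by rewrite ler_nat.
pose K : R := m%:R * (N%:R * n%:R ^+ 2).
have K0 : 0 < K by rewrite /K !mulr_gt0 ?exprn_gt0.
have EK : \sum_i E i <= #|I|%:R * K.
  apply: le_trans Es _; rewrite /K mulrCA ler_wpM2l // ler_wpM2l //.
  by rewrite ler_wpM2r // sqr_ge0.
(* Markov: the mean of [E i] is at most [K], so at least half of the indices lie in [G]. *)
pose G := [set i | E i <= 2 * K].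
have cardG : (#|I| <= 2 * #|G|)%N.
  have : #|~: G|%:R * (2 * K) <= #|I|%:R * K.
    apply: le_trans EK; rewrite [leRHS](bigID (mem (~: G))) /=.
    rewrite mulr_natl -sumr_const; apply: ler_wpDr; first exact: sumr_ge0.
    by apply: ler_sum => i; rewrite !inE -ltNge => /ltW.
  rewrite mulrA ler_pM2r // -natrM ler_nat -(cardsC G).
  by rewrite muln2 mul2n -!addnn leq_add2r leq_add2l.
rewrite leqNgt; apply/negP => ltI.
have : (2 ^ m < #|G|)%N.
  by rewrite -(ltn_pmul2l (isT : 0 < 2)%N) (leq_trans ltI).
(* Pigeonhole: there are only [2 ^ m] traces on the sample, so two indices of [G] share one. *)
pose tr i := [tuple of map (fun z => z \in A i) s].
have cardm : #|{: m.-tuple bool}| = (2 ^ m)%N by rewrite card_tuple card_bool.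
rewrite -cardm ltnNge => /negP; apply.
rewrite -(@card_in_imset _ _ tr G) ?max_card // => i j iG jG trij.
apply/eqP; apply: contraT => neq_ij.
have trE : {in s, forall z, (z \in A i) = (z \in A j)}.
  by have /= := congr1 val trij; move/eq_in_map.
have cj0 L : L \in B j -> c j L = 0.
  move=> LB; rewrite /c; apply/eqP; rewrite pnatr_eq0 cards_eq0; apply/eqP/setP => z.
  by rewrite !inE; apply/negP => /andP[zA]; apply/negP; apply: diag LB.
have hij L : \sum_(z <- s) h j L z - \sum_(z <- s) h i L z = m%:R * (c i L - c j L).
  rewrite -sumrB (eq_big_seq (fun=> c i L - c j L)) => [|z /trE tz].
    by rewrite big_const_seq count_predT size_tuple iter_addr_0 mulr_natl.
  by rewrite /h /a tz; ring.
(* Equal traces leave only the degrees in the difference of deviations, and [c j] vanishes on [B j].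
   The 8 comes from [(x - y)^2 <= 2 (x^2 + y^2)] with [E i + E j <= 4 K]. *)
have sumc : m%:R ^+ 2 * \sum_(L in B j) c i L ^+ 2 <= 8 * K.
  move: iG jG; rewrite !inE => iG jG.
  apply: (@le_trans _ _ (2 * (E i + E j))); last by lra.
  rewrite /E -big_split /= !mulr_sumr.
  rewrite [leRHS](bigID (mem (B j))) /=.
  apply: ler_wpDr.
    by apply: sumr_ge0 => L _; rewrite mulr_ge0 // addr_ge0 ?sqr_ge0.
  rewrite [leRHS](eq_bigl (mem (B j))) => [|L]; last first.
    by rewrite andb_idl //; apply: (subsetP (BD j)).
  apply: ler_sum => L LB; have := hij L; rewrite (cj0 L LB) subr0 -exprMn => <-.
  set x := \sum_(_ <- _) _; set y := \sum_(_ <- _) _.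
  by have := sqr_ge0 (x + y); nra.
(* Cauchy-Schwarz, as AM-GM against the constant [b n], since [B j] has at most [N] elements. *)
have sumc' : b ^+ 2 * n%:R ^+ 2 * N%:R <= \sum_(L in B j) c i L ^+ 2.
  have AG L : 2 * (b * n%:R) * c i L <= (b * n%:R) ^+ 2 + c i L ^+ 2.
    by have := sqr_ge0 (b * n%:R - c i L); nra.
  have : \sum_(L in B j) 2 * (b * n%:R) * c i L <=
         (b * n%:R) ^+ 2 * N%:R + \sum_(L in B j) c i L ^+ 2.
    apply: (@le_trans _ _ (\sum_(L in B j) ((b * n%:R) ^+ 2 + c i L ^+ 2))).
      by apply: ler_sum => L _; exact: AG.
    rewrite big_split /= lerD2r sumr_const -[leLHS]mulr_natr ler_wpM2l ?sqr_ge0 //.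
    by rewrite ler_nat (leq_trans (subset_leq_card (BD j))).
  have bn0 : 0 < b * n%:R := mulr_gt0 b0 n0.
  have : b * n%:R * N%:R <= \sum_(L in B j) c i L := off i j neq_ij.
  move/(ler_wpM2l (ltW bn0)); rewrite -mulr_sumr.
  move: (\sum_(L in B j) c i L) => X; move: (\sum_(L in B j) _) => Y.
  by nra.
suff : 8 * K < m%:R ^+ 2 * \sum_(L in B j) c i L ^+ 2 by rewrite ltNge sumc.
apply: (@lt_le_trans _ _ (m%:R ^+ 2 * (b ^+ 2 * n%:R ^+ 2 * N%:R))); last first.
  by rewrite ler_wpM2l // sqr_ge0.
rewrite (_ : m%:R ^+ 2 * _ = m%:R * b ^+ 2 * K); last by rewrite /K; ring.
by rewrite ltr_pM2r.
Qed.

(** * Counting subsets of given size *)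

Lemma card_subsets_le (T : finType) (k : nat) :
  (#|[set K : {set T} | #|K| == k]| <= #|T| ^ k)%N.
Proof.
have ffact_le : forall n, (n ^_ k <= n ^ k)%N.
  elim: k => // k IH n; rewrite ffactnS expnS leq_mul2l.
  rewrite (leq_trans (IH _)) ?orbT //.
  by case: k {IH} => // k; rewrite leq_exp2r // leq_pred.
rewrite card_draws (leq_trans _ (ffact_le _)) // -bin_ffact.
by rewrite leq_pmulr // fact_gt0.
Qed.

Lemma card_subsets_containing (T : finType) (z : T) (k : nat) :
  (#|[set K : {set T} | (z \in K) && (#|K| == k.+1)]| <= #|T| ^ k)%N.
Proof.
set S := [set K | _].
have Sinj : {in S &, injective (fun K => K :\ z)}.
  move=> K K'; rewrite !inE => /andP[zK _] /andP[zK' _] KK'.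
  by rewrite -(setD1K zK) KK' setD1K.
rewrite -(card_in_imset Sinj).
apply: (@leq_trans #|[set K : {set T} | #|K| == k]|).
  apply/subset_leq_card/subsetP => _ /imsetP[K + ->].
  by rewrite !inE (cardsD1 z K) => /andP[-> ]; rewrite add1n eqSS.
exact: card_subsets_le.
Qed.

(** * Induced matchings in ultra maximal graphs *)

Section UltraMaximal.
Variables (T : finType) (e : rel T).
Hypotheses (eS : symmetric e) (eI : irreflexive e).

Lemma cliqueP (S : {set T}) :
  reflect {in S &, forall x y, x != y -> e x y} (clique e S).
Proof.
apply: (iffP forall_inP) => [H x y xS yS|H x xS].
  by have /forall_inP/(_ y yS)/implyP := H x xS.
by apply/forall_inP => y yS; apply/implyP; apply: H.
Qed.

(** For an (r-2)-clique [S] this produces the forbidden [K_r]. *)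
Lemma clique_add2 (x y : T) (S : {set T}) :
  clique e S -> e x y -> S \subset nbhd e x -> S \subset nbhd e y ->
  clique e (x |: (y |: S)) /\ #|x |: (y |: S)| = #|S|.+2.
Proof.
move=> /cliqueP cS exy /subsetP Sx /subsetP Sy.
have {}Sx z : z \in S -> e x z by move=> /Sx; rewrite inE.
have {}Sy z : z \in S -> e y z by move=> /Sy; rewrite inE.
split.
  apply/cliqueP => a b; rewrite !inE.
  move=> /predU1P[->|/predU1P[->|aS]] /predU1P[->|/predU1P[->|bS]];
    rewrite ?eqxx // => ab; [exact: Sx|by rewrite eS|exact: Sy|..].
  - by rewrite eS Sx.
  - by rewrite eS Sy.
  - exact: cS.
rewrite !cardsU1 !inE.
rewrite (_ : y \in S = false); last by apply/negP => /Sy; rewrite eI.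
rewrite (_ : x \in S = false); last by apply/negP => /Sx; rewrite eI.
by case: eqP exy => [->|//]; rewrite eI.
Qed.

(** Below [2 / alpha] vertices, [t] is bounded by the order of the graph; otherwise the sampling
    bound applies to the sets [N(u_i)] and the (r-2)-cliques inside them. *)
Lemma ultra_maximal_bim (R : realType) (alpha : R) (r m t : nat) :
  (3 <= r)%N -> 0 < alpha -> ultra_maximal_Kr_free e alpha r ->
  8 < m%:R * (alpha ^+ 2 / 2) ^+ 2 ->
  has_bim e t -> (t <= maxn (Num.bound (2 / alpha)) (2 * 2 ^ m))%N.
Proof.
case: r => [|[|[|k]]] // _ a0 [Kfree umax] am [u [v [uI vI uv uvE]]].
rewrite !subSS subn0 in umax.
have tn : (t <= #|T|)%N by rewrite -[t]card_ord; apply: leq_card uI.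
rewrite leq_max; apply/orP.
have [small|large] := ltP (#|T|%:R : R) (2 / alpha).
  left; apply: (leq_trans tn); rewrite -(ler_nat R).
  by apply/ltW/(lt_trans small)/archi_boundP; rewrite divr_ge0 // ltW.
right.
have n0 : (0 < #|T|)%N.
  by rewrite -(ltr_nat R); apply: lt_le_trans large; rewrite divr_gt0.
pose D := [set L : {set T} | (#|L| == k.+1) && clique e L].
pose B (i : 'I_t) := [set L in D | L \subset nbhd e (u i)].
pose M z (L : {set T}) := L \subset nbhd e z.
have noK (x y : T) (L : {set T}) : L \in D -> e x y ->
    L \subset nbhd e x -> L \subset nbhd e y -> False.
  rewrite inE => /andP[/eqP cL qL] exy Lx Ly.
  have [q c] := clique_add2 qL exy Lx Ly.
  by have := Kfree (x |: (y |: L)); rewrite c cL q => /(_ erefl).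
rewrite -[t]card_ord.
apply: (@diagonal_free_bound R T {set T} 'I_t D (fun i => nbhd e (u i)) B M
         (#|T| ^ k.+1) m (alpha ^+ 2 / 2)) => //.
- by rewrite expn_gt0 n0.
- apply: (@leq_trans #|[set L : {set T} | #|L| == k.+1]|).
    by apply/subset_leq_card/subsetP => L; rewrite !inE => /andP[].
  exact: card_subsets_le.
- by rewrite divr_gt0 ?exprn_gt0.
- by move=> i; apply/subsetP => L; rewrite inE => /andP[].
- move=> i z L; rewrite [z \in _]inE [L \in _]inE => uz /andP[LD Lu].
  by apply/negP => Lz; apply: (noK _ _ L LD uz).
move=> i j neq_ij.
have nuv : ~~ e (u i) (v j) by rewrite uvE.
pose Z := [set z in nbhd e (u i) | ~~ e (u j) z].
(* Otherwise [K] together with the edge [u j]-[v j] is a [K_r]. *)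
have hit (K : {set T}) : K \in D -> K \subset nbhd e (u i) :&: nbhd e (v j) ->
    exists2 z, z \in Z & z \in K.
  move=> KD; rewrite subsetI => /andP[Ku Kv].
  have : ~~ (K \subset nbhd e (u j)).
    by apply/negP => Kuj; apply: (noK (u j) (v j) K); rewrite // uvE eqxx.
  case/subsetPn => z zK; rewrite inE => nz; exists z => //.
  by rewrite inE nz andbT (subsetP Ku).
(* Each of the at least [alpha n^(k+1)] common cliques meets [Z], and a vertex lies in at most [n^k]
   of them. *)
have cardZ : alpha * #|T|%:R <= #|Z|%:R.
  have : (common_cliques e k.+1 (u i) (v j) <= #|Z| * #|T| ^ k)%N.
    rewrite /common_cliques -sum_nat_const.
    apply: (@leq_trans
      #|\bigcup_(z in Z) [set K : {set T} | (z \in K) && (#|K| == k.+1)]|).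
      apply/subset_leq_card/subsetP => K; rewrite inE => /andP[/andP[Kuv cK] qK].
      have [|z zZ zK] := hit K _ Kuv; first by rewrite inE cK.
      by apply/bigcupP; exists z; rewrite // inE zK.
    elim/big_rec2: _ => [|z n A zZ le_n]; first by rewrite cards0.
    by rewrite (leq_trans (leq_card_setU _ _)) // leq_add // card_subsets_containing.
  rewrite -(ler_nat R) => /(le_trans (umax _ _ (uv i j) nuv)).
  by rewrite natrM natrX exprSr mulrA mulrAC ler_pM2r // exprn_gt0 // ltr0n.
(* [u j] is not its own neighbour and may lie in [Z], but ultra maximality concerns distinct
   vertices. Dropping it costs 1, at most [alpha n / 2] for large [n]. *)
pose Z' := Z :\ u j.
have cardZ' : alpha * #|T|%:R / 2 <= #|Z'|%:R.
  have : #|Z|%:R <= 1 + #|Z'|%:R :> R.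
    by rewrite (cardsD1 (u j) Z) natrD lerD2r; case: (_ \in _).
  move: large; rewrite ler_pdivrMr //; move: cardZ; lra.
apply: (@le_trans _ _ (#|Z'|%:R * (alpha * #|T|%:R ^+ k.+1))).
  rewrite natrX.
  have x0 : 0 <= alpha * #|T|%:R ^+ k.+1 by rewrite mulr_ge0 ?exprn_ge0 // ltW.
  apply: le_trans (ler_wpM2r x0 cardZ').
  by rewrite le_eqVlt; apply/orP; left; apply/eqP; field.
(* Double counting: grouped by [z], each term with [z] in [Z'] counts common cliques of [u j] and
   [z]. *)
have -> : \sum_(L in B j) #|[set z in nbhd e (u i) | M z L]|%:R =
    \sum_(z in nbhd e (u i)) #|[set L in B j | M z L]|%:R :> R.
  have cardE (X Y : finType) (P : {pred X}) (Q : {set Y}) (m' : X -> Y -> bool) :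
      \sum_(x in P) #|[set y in Q | m' x y]|%:R =
      \sum_(x in P) \sum_(y in Q) (m' x y)%:R :> R.
    apply: eq_bigr => x _; rewrite -sum1_card natr_sum big_mkcond [RHS]big_mkcond /=.
    by apply: eq_bigr => y _; rewrite inE; case: (y \in Q); case: (m' x y).
  by rewrite (cardE _ _ _ _ (fun L z => M z L)) cardE exchange_big.
have Z'u : Z' \subset nbhd e (u i).
  by apply/subsetP => z; rewrite !inE => /andP[_ /andP[]].
rewrite (bigID (mem Z')) /=; apply: ler_wpDr; first exact: sumr_ge0.
rewrite (eq_bigl (mem Z')) => [|z]; last first.
  by rewrite andb_idl //; apply: (subsetP Z'u).
rewrite mulr_natl -sumr_const; apply: ler_sum => z.
rewrite !inE => /andP[zuj /andP[_ nz]].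
apply: le_trans (umax (u j) z _ nz) _; first by rewrite eq_sym.
rewrite ler_nat; apply/subset_leq_card/subsetP => L.
by rewrite !inE subsetI /M => /andP[/andP[/andP[-> ->] ->] ->].
Qed.

End UltraMaximal.

Local Close Scope ring_scope.

Theorem theorem1p4 :
  (exists C : nat -> nat -> nat,
    forall (r t : nat) (T : finType) (e : rel T)
           (F : {set {set {set T}}}),
      3 <= r -> simple_graph e -> bim_number e t ->
      F \subset convexity_space e ->
      (forall A, A \in F -> A != set0) ->
      r2_property r F ->
      exists X : {set {set T}}, mis_transversal e F X /\ #|X| <= C r t)
  /\
  (forall R : realType, exists C' : nat -> R -> nat,
    forall (r : nat) (alpha : R) (T : finType) (e : rel T)
           (F : {set {set {set T}}}),
      3 <= r -> (0 < alpha)%R -> simple_graph e ->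
      ultra_maximal_Kr_free e alpha r ->
      F \subset convexity_space e ->
      (forall A, A \in F -> A != set0) ->
      r2_property r F ->
      exists X : {set {set T}}, mis_transversal e F X /\ #|X| <= C' r alpha).

Proof.
split.
  exists transversal_bound => r t T e F _ [eS eI] [_ le_t].
  exact: convexity_transversal.
move=> R.
(* [Num.bound x] exceeds [x], so [8 < m b^2] for [b = alpha^2 / 2]. *)
pose m (alpha : R) := Num.bound (8 / (alpha ^+ 2 / 2) ^+ 2).
exists (fun r alpha => transversal_bound r
  (maxn (Num.bound (2 / alpha)) (2 * 2 ^ m alpha))) => r alpha T e F r3 a0 [eS eI] um.
apply: (convexity_transversal eS) => t; apply: (ultra_maximal_bim eS eI r3 a0 um).
have a20 : (0 < (alpha ^+ 2 / 2) ^+ 2)%R by rewrite exprn_gt0 ?divr_gt0 ?exprn_gt0.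
by rewrite -ltr_pdivrMr // archi_boundP // divr_ge0 // ltW.
Qed.
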